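(* Let $\sigma$ be a functional signature disjoint from $\{-,\triangleright\}$. There is an adjunction $F'\dashv G'$ with $F'\colon\mathbf{AtRepAlg}(\sigma)\to\mathbf{Set_q}(\sigma)^{\mathrm{op}}$ and $G'\colon\mathbf{Set_q}(\sigma)^{\mathrm{op}}\to\mathbf{AtRepAlg}(\sigma)$ that extends the adjunction $F\dashv G$ between $\mathbf{AtRepAlg}$ and $\mathbf{Set_q}^{\mathrm{op}}$ (described in the context), in the sense that the appropriate reducts of $F'(\mathfrak A)$ and $G'(\pi\colon X\twoheadrightarrow X_0)$ (the underlying set quotient of $F'(\mathfrak A)$, forgetting the relations, and the $\{-,\triangleright\}$-reduct of $G'(\pi)$) equal $F(\mathfrak A)$ and $G(\pi\colon X\twoheadrightarrow X_0)$, respectively, where $F$ is applied to the $\{-,\triangleright\}$-reduct of $\mathfrak A$ and $G$ to the underlying set quotient.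
   Context: **Algebras.** A partial function from $X$ to $Y$ is a set $f\subseteq X\times Y$ such that $(x,y),(x,z)\in f$ implies $y=z$; $\mathrm{dom}(f)=\{x\mid \exists y\,(x,y)\in f\}$; $f\colon X\rightharpoonup Y$ denotes a partial function. An algebra of partial functions of the signature $\{-,\triangleright\}$ is a nonempty set of partial functions from some common set $X$ to some common set $Y$, closed under relative complement $f-g$ (set difference) and domain restriction $f\triangleright g=\{(x,y)\in g\mid x\in\mathrm{dom}(f)\}$. An abstract $\{-,\triangleright\}$-algebra (two binary operations) is representable if it is isomorphic to an algebra of partial functions. Put $a\cdot b:=a-(a-b)$; a representable algebra is partially ordered by $a\le b\iff a\cdot b=a$, with binary meet $\cdot$ and least element $0$. An atom is a minimal nonzero element; $\mathrm{At}(\mathfrak A)$ is the set of atoms; $\mathfrak A$ is atomic if every nonzero element is above an atom. $a^\downarrow=\{x\mid x\le a\}$, which is a Boolean algebra. Elements $a,b$ of a representable algebra are compatible if $a\triangleright b=b\triangleright a$. **Complete homomorphisms.** A homomorphism $h$ of representable $\{-,\triangleright\}$-algebras is complete if it preserves all existing joins (whenever $\sum S$ exists, $\sum h[S]$ exists and equals $h(\sum S)$); for homomorphisms of representable algebras this is equivalent to preserving all existing meets of nonempty subsets. **Base categories.** $\mathbf{AtRepAlg}$: objects are atomic representable $\{-,\triangleright\}$-algebras, morphisms are complete homomorphisms. $\mathbf{Set_q}$: objects are surjective (total) functions $\pi\colon X\twoheadrightarrow X_0$ between sets; a morphism from $\pi\colon X\twoheadrightarrow X_0$ to $\rho\colon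 Y\twoheadrightarrow Y_0$ is a partial function $\varphi\colon X\rightharpoonup Y$ such that (Q.1) if $\varphi(x),\varphi(x')$ are defined and $\pi(x)=\pi(x')$ then $\rho(\varphi(x))=\rho(\varphi(x'))$, so that $\widetilde\varphi:=\{(\pi(x),\rho(\varphi(x)))\mid x\in\mathrm{dom}(\varphi)\}$ is a partial function $X_0\rightharpoonup Y_0$; and for every $(x_0,y_0)\in\widetilde\varphi$ the partial map $\pi^{-1}(x_0)\rightharpoonup\rho^{-1}(y_0)$ obtained by restricting and co-restricting $\varphi$ is (Q.2) injective and (Q.3) surjective (its image is all of $\rho^{-1}(y_0)$). Composition is the usual composition of partial functions. **The functors $F,G$.** On a representable $\mathfrak A$ let $a\preceq_{\mathfrak A}b\iff a\le b\triangleright a$ (a preorder), with induced equivalence relation $\sim_{\mathfrak A}$. $F(\mathfrak A)$ is the canonical projection $\pi_{\mathfrak A}\colon\mathrm{At}(\mathfrak A)\twoheadrightarrow\mathrm{At}(\mathfrak A)/{\sim_{\mathfrak A}}$. For a complete homomorphism $h\colon\mathfrak A\to\mathfrak B$, $Fh\colon\mathrm{At}(\mathfrak B)\rightharpoonup\mathrm{At}(\mathfrak A)$ has domain $\bigcup_{a\in\mathfrak A}\mathrm{At}(h(a)^\downarrow)$ and, for an atom $y\le h(a)$, $Fh(y)$ is the atom $\varphi_a(y)$ of $a^\downarrow$ determined by: for all $a'\le a$, $\varphi_a(y)\le a'\iff y\le h(a')$ (independent of the choice of $a$). $G(\pi)=\mathfrak A_\pi$ is the $\{-,\triangleright\}$-algebra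 of all partial functions $f\colon X_0\rightharpoonup X$ with $f\subseteq\pi^{-1}=\{(\pi(x),x)\mid x\in X\}$. For a morphism $\varphi$ from $\pi\colon X\twoheadrightarrow X_0$ to $\rho\colon Y\twoheadrightarrow Y_0$, $G\varphi\colon\mathfrak A_\rho\to\mathfrak A_\pi$ is $G\varphi(g)=\{(\pi(x),x)\mid x\in\mathrm{dom}(\varphi)\text{ and }(\rho(\varphi(x)),\varphi(x))\in g\}$. It is known that $F\colon\mathbf{AtRepAlg}\to\mathbf{Set_q}^{\mathrm{op}}$ is left adjoint to $G\colon\mathbf{Set_q}^{\mathrm{op}}\to\mathbf{AtRepAlg}$. **Operators.** An $n$-ary operation $\Omega$ on $\mathfrak A$ is compatibility preserving if whenever $a_i,a_i'$ are compatible for all $i$, then $\Omega(a_1,\dots,a_n)$ and $\Omega(a_1',\dots,a_n')$ are compatible. It is completely additive if whenever $S\subseteq\mathfrak A$ has a supremum $\sum S$, then for every $i$ and all $a_j$ ($j\ne i$), $\Omega(a_1,\dots,a_{i-1},\sum S,a_{i+1},\dots,a_n)=\sum\{\Omega(a_1,\dots,a_{i-1},s,a_{i+1},\dots,a_n)\mid s\in S\}$. **The category $\mathbf{AtRepAlg}(\sigma)$.** Objects: algebras of signature $\{-,\triangleright\}\cup\sigma$ whose $\{-,\triangleright\}$-reduct is atomic and representable and in which the symbols of $\sigma$ are interpreted as compatibility preserving completely additive operations. Morphisms: complete homomorphisms of $(\{-,\triangleright\}\cup\sigma)$-algebras. **The category $\mathbf{Set_q}(\sigma)$.** For $\pi\colon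 X\twoheadrightarrow X_0$ define $C\subseteq X\times X$ by $xCy$ iff ($\pi(x)=\pi(y)\Rightarrow x=y$). An $(n+1)$-ary relation $R$ on $X$ has the compatibility property if $x_1Cx_1',\dots,x_nCx_n'$, $Rx_1\dots x_{n+1}$ and $Rx_1'\dots x_{n+1}'$ imply $x_{n+1}Cx_{n+1}'$. Objects of $\mathbf{Set_q}(\sigma)$: objects of $\mathbf{Set_q}$ equipped with, for each $\Omega\in\sigma$ of arity $n$, an $(n+1)$-ary relation $R_\Omega$ on $X$ with the compatibility property. Morphisms: morphisms $\varphi\colon X\rightharpoonup Y$ of $\mathbf{Set_q}$ satisfying, for each $\Omega\in\sigma$, with $R_X,R_Y$ the corresponding relations on $X$ and $Y$: (reverse forth) if $R_Xx_1\dots x_{n+1}$ and $\varphi(x_1),\dots,\varphi(x_n)$ are defined, then $\varphi(x_{n+1})$ is defined and $R_Y\varphi(x_1)\dots\varphi(x_{n+1})$; (back) if $\varphi(x_{n+1})$ is defined and $R_Yy_1\dots y_n\varphi(x_{n+1})$, then there exist $x_1,\dots,x_n\in\mathrm{dom}(\varphi)$ with $\varphi(x_i)=y_i$ for all $i\le n$ and $R_Xx_1\dots x_{n+1}$. *)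

(* Defs.v *)
From mathcomp Require Import all_boot.
From mathcomp Require Import boolp classical_sets functions.
Set Implicit Arguments.
Unset Strict Implicit.
Unset Printing Implicit Defensive.
Local Open Scope classical_set_scope.

Record category := Category {
  obj :> Type;
  hom : obj -> obj -> Type;
  idm : forall a, hom a a;
  comp : forall a b c, hom b c -> hom a b -> hom a c;
  comp_idl : forall a b (f : hom a b), comp (idm b) f = f;
  comp_idr : forall a b (f : hom a b), comp f (idm a) = f;
  compA : forall a b c d (f : hom c d) (g : hom b c) (h : hom a b),
    comp f (comp g h) = comp (comp f g) h }.
Arguments hom {_} _ _.
Arguments idm {_} _.
Arguments comp {_ _ _ _} _ _.

Record functor (C D : category) := Functor {
  fobj :> C -> D;
  fmap : forall a b : C, hom a b -> hom (fobj a) (fobj b);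
  fmap_id : forall a : C, fmap (idm a) = idm (fobj a);
  fmap_comp : forall (a b c : C) (f : hom b c) (g : hom a b),
    fmap (comp f g) = comp (fmap f) (fmap g) }.
Arguments fmap {_ _} _ {_ _} _.

Definition op (C : category) : category :=
  @Category C (fun a b => @hom C b a) (fun a => @idm C a)
    (fun a b c f g => comp g f)
    (fun a b f => comp_idr f) (fun a b f => comp_idl f)
    (fun a b c d f g h => esym (compA h g f)).

Definition functor_comp (C D E : category) (G : functor D E) (F : functor C D) :
  functor C E.
Proof.
apply: (@Functor C E (fun a => G (F a)) (fun a b f => fmap G (fmap F f))).
- by move=> a; rewrite !fmap_id.
- by move=> a b c f g; rewrite !fmap_comp.
Defined.

Definition functor_op (C D : category) (F : functor C D) :
  functor (op C) (op D) :=
  @Functor (op C) (op D) F (fun a b f => fmap F f)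
    (fun a => fmap_id F a) (fun a b c f g => fmap_comp F g f).

Definition left_adjoint (C D : category) (F : functor C D) (G : functor D C) :=
  exists tr : forall (c : C) (d : D), hom (F c) d -> hom c (G d),
    (forall c d, bijective (tr c d)) /\
    (forall (c c' : C) (d d' : D) (k : hom c' c) (f : hom (F c) d)
            (g : hom d d'),
       tr c' d' (comp g (comp f (fmap F k))) =
       comp (fmap G g) (comp (tr c d f) k)).

Definition pfun X Y (f : set (X * Y)) :=
  forall x y z, f (x, y) -> f (x, z) -> y = z.

Definition pdom X Y (f : set (X * Y)) : set X := [set x | exists y, f (x, y)].

Definition pdres X Y (f g : set (X * Y)) : set (X * Y) :=
  [set p | g p /\ pdom f p.1].

Definition pfun_algebra X Y (K : set (set (X * Y))) :=
  [/\ K !=set0,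
      (forall f, K f -> pfun f),
      (forall f g, K f -> K g -> K (f `\` g))
    & (forall f g, K f -> K g -> K (pdres f g))].

Lemma sval_inj T (P : T -> Prop) : injective (@sval T P).
Proof. by move=> [x px] [y py] /= xy; apply: eq_exist. Qed.

Record alg := Alg {
  car :> Type;
  diff : car -> car -> car;
  dres : car -> car -> car }.
Arguments diff {_} _ _.
Arguments dres {_} _ _.

(* [X] and [Y] range over a fixed universe of types, playing the role of sets. *)
Definition representable (A : alg) :=
  exists (X Y : Type) (K : set (set (X * Y))) (theta : A -> set (X * Y)),
    [/\ pfun_algebra K, set_bij [set: A] K theta,
        (forall a b, theta (diff a b) = theta a `\` theta b)
      & (forall a b, theta (dres a b) = pdres (theta a) (theta b))].

Section Algebra.
Variable A : alg.
Implicit Types (a b z : A) (S : set A).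

Definition meet a b := diff a (diff a b).
Definition le a b := meet a b = a.
Definition is_zero z := forall a, le z a.
Definition atom (x : A) := ~ is_zero x /\ forall a, le a x -> is_zero a \/ a = x.
Definition atomic := forall a, ~ is_zero a -> exists2 x, atom x & le x a.
Definition compatible a b := dres a b = dres b a.
Definition is_join S a :=
  (forall b, S b -> le b a) /\ (forall c, (forall b, S b -> le b c) -> le a c).

Definition preceq a b := le a (dres b a).
Definition sim a b := preceq a b /\ preceq b a.

Definition At := {x : A | atom x}.
Definition At_class (x : At) : set At := [set y | sim (sval x) (sval y)].
Definition At_quot := {c : set At | exists x, c = At_class x}.
Definition At_proj (x : At) : At_quot :=
  exist _ (At_class x) (ex_intro _ x erefl).

Lemma At_proj_surj (c : At_quot) : exists x, At_proj x = c.
Proof. by case: c => c [x cx]; exists x; apply: eq_exist. Qed.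

End Algebra.

Definition alg_hom (A B : alg) (h : A -> B) :=
  (forall a b, h (diff a b) = diff (h a) (h b)) /\
  (forall a b, h (dres a b) = dres (h a) (h b)).

Definition complete (A B : alg) (h : A -> B) :=
  forall S s, is_join S s -> is_join (h @` S) (h s).

Record atRepAlg := AtRepAlgObj {
  ar_alg :> alg;
  ar_rep : representable ar_alg;
  ar_atomic : atomic ar_alg }.

Record complete_hom (A B : alg) := CompleteHom {
  chom :> A -> B;
  chom_hom : alg_hom chom;
  chom_complete : complete chom }.

Lemma complete_hom_eq (A B : alg) (h k : complete_hom A B) :
  (forall a, h a = k a) -> h = k.
Proof.
case: h k => [h hh hc] [k kh kc] /= /funext hk; subst k.
by rewrite (Prop_irrelevance hh kh) (Prop_irrelevance hc kc).
Qed.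

Lemma alg_hom_comp (A B C : alg) (h : B -> C) (k : A -> B) :
  alg_hom h -> alg_hom k -> alg_hom (h \o k).
Proof. by case=> h1 h2 [k1 k2]; split=> a b /=; rewrite ?k1 ?k2. Qed.

Lemma complete_comp (A B C : alg) (h : B -> C) (k : A -> B) :
  complete h -> complete k -> complete (h \o k).
Proof. by move=> hc kc S s /kc /hc; rewrite image_comp. Qed.

Lemma complete_id (A : alg) : complete (@id A).
Proof. by move=> S s; rewrite image_id. Qed.

Definition chom_id (A : alg) : complete_hom A A :=
  CompleteHom (conj (fun _ _ => erefl) (fun _ _ => erefl)) (@complete_id A).

Definition chom_comp (A B C : alg) (h : complete_hom B C)
    (k : complete_hom A B) : complete_hom A C :=
  CompleteHom (alg_hom_comp (chom_hom h) (chom_hom k))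
              (complete_comp (chom_complete h) (chom_complete k)).

Definition AtRepAlg : category.
Proof.
apply: (@Category atRepAlg (fun A B => complete_hom A B)
          (fun A => chom_id A) (fun A B C h k => chom_comp h k)).
- by move=> A B f; apply: complete_hom_eq.
- by move=> A B f; apply: complete_hom_eq.
- by move=> A B C D f g h; apply: complete_hom_eq.
Defined.

Record setq := SetqObj {
  qset : Type;
  qbase : Type;
  qproj : qset -> qbase;
  qproj_surj : forall x0, exists x, qproj x = x0 }.

Section SetqMorphisms.
Variables P Q : setq.
Implicit Type phi : set (qset P * qset Q).

Definition Q1 phi := forall x x' y y', phi (x, y) -> phi (x', y') ->
  qproj x = qproj x' -> qproj y = qproj y'.

Definition induced phi : set (qbase P * qbase Q) :=
  [set (qproj p.1, qproj p.2) | p in phi].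

Definition fibre_restr phi (x0 : qbase P) (y0 : qbase Q) :
    set (qset P * qset Q) :=
  [set p | [/\ phi p, qproj p.1 = x0 & qproj p.2 = y0]].

Definition Q2 phi := forall x0 y0, induced phi (x0, y0) ->
  forall x x' y, fibre_restr phi x0 y0 (x, y) ->
    fibre_restr phi x0 y0 (x', y) -> x = x'.

Definition Q3 phi := forall x0 y0, induced phi (x0, y0) ->
  forall y, qproj y = y0 -> exists x, fibre_restr phi x0 y0 (x, y).

Record setq_hom := SetqHom {
  qmap : set (qset P * qset Q);
  qmap_pfun : pfun qmap;
  qmap_Q1 : Q1 qmap;
  qmap_Q2 : Q2 qmap;
  qmap_Q3 : Q3 qmap }.

Lemma setq_hom_eq (f g : setq_hom) :
  (forall x y, qmap f (x, y) <-> qmap g (x, y)) -> f = g.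
Proof.
case: f g => [f f0 f1 f2 f3] [g g0 g1 g2 g3] /= fg.
have {}fg : f = g by apply/seteqP; split=> -[x y] /fg.
subst g; rewrite (Prop_irrelevance f0 g0) (Prop_irrelevance f1 g1).
by rewrite (Prop_irrelevance f2 g2) (Prop_irrelevance f3 g3).
Qed.

Lemma Q2P (f : setq_hom) x x' y :
  qmap f (x, y) -> qmap f (x', y) -> qproj x = qproj x' -> x = x'.
Proof.
move=> fx fx' e; apply: (@qmap_Q2 f (qproj x) (qproj y) _ x x' y) => //.
by exists (x, y).
Qed.

Lemma Q3P (f : setq_hom) x y y' : qmap f (x, y) -> qproj y' = qproj y ->
  exists2 x', qmap f (x', y') & qproj x' = qproj x.
Proof.
move=> fx e; have [|x' [fx' ? _]] := @qmap_Q3 f (qproj x) (qproj y) _ y' e.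
  by exists (x, y).
by exists x'.
Qed.

End SetqMorphisms.

Definition setq_id (P : setq) : setq_hom P P.
Proof.
apply: (@SetqHom P P [set p | p.1 = p.2]).
- by move=> x y z /= <- <-.
- by move=> x x' y y' /= -> ->.
- by move=> x0 y0 _ x x' y /= [/= -> _ _] [/= -> _ _].
- by move=> x0 y0 [[x y] /= -> [<- <-]] z zy; exists z; split.
Defined.

(* In [classical_sets], [B \; A] applies [A] first. *)
Definition setq_comp (P Q R : setq) (psi : setq_hom Q R) (phi : setq_hom P Q) :
  setq_hom P R.
Proof.
apply: (@SetqHom P R (qmap psi \; qmap phi)%relation).
- move=> x z z' /= [y xy yz] [y' xy' yz'].
  rewrite (qmap_pfun xy xy') in yz; exact: qmap_pfun yz yz'.
- move=> x x' z z' /= [y xy yz] [y' xy' yz'] e.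
  exact: qmap_Q1 yz yz' (qmap_Q1 xy xy' e).
- move=> x0 z0 _ x x' z [/= [y xy yz] ex ez] [/= [y' xy' yz'] ex' _].
  have e : qproj x = qproj x' by rewrite ex.
  have eyy := Q2P yz yz' (qmap_Q1 xy xy' e); rewrite -eyy in xy'.
  exact: Q2P xy xy' e.
- move=> x0 z0 [[x z] /= [y xy yz] [<- <-]] z' zz'.
  have [y' yz' ey'] := Q3P yz zz'.
  have [x' xy' ex'] := Q3P xy ey'.
  by exists x'; split=> //=; exists y'.
Defined.

Definition Setq : category.
Proof.
apply: (@Category setq setq_hom setq_id setq_comp).
- move=> P Q f; apply: setq_hom_eq => x y /=; split=> [[z fz <-]//|fxy].
  by exists y.
- move=> P Q f; apply: setq_hom_eq => x y /=; split=> [[z -> fz]//|fxy].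
  by exists x.
- move=> P Q R S f g h; apply: setq_hom_eq => x y /=; split.
    by case=> [z [w hw gz] fy]; exists w => //; exists z.
  by case=> [w hw [z gz fy]]; exists z => //; exists w.
Defined.

Lemma rep_embed (A : alg) : representable A ->
  exists (X Y : Type) (t : A -> set (X * Y)),
    [/\ injective t, (forall a, pfun (t a)),
        (forall a b, t (diff a b) = t a `\` t b)
      & (forall a b, t (dres a b) = pdres (t a) (t b))].
Proof.
case=> [X [Y [K [t [[_ Kp _ _] [tK tinj _] td tr]]]]]; exists X, Y, t; split=> //.
- by move=> a b e; apply: (tinj a b) => //; rewrite inE.
- by move=> a; apply/Kp/tK.
Qed.

Section Rep.
Variables (A : alg) (X Y : Type) (t : A -> set (X * Y)).
Hypotheses (tinj : injective t) (tp : forall a, pfun (t a))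
  (td : forall a b, t (diff a b) = t a `\` t b)
  (tr : forall a b, t (dres a b) = pdres (t a) (t b)).

Lemma rep_meet a b : t (meet a b) = t a `&` t b.
Proof. by rewrite /meet !td setDD. Qed.

Lemma rep_le a b : le a b <-> t a `<=` t b.
Proof.
split=> [ab|ab]; first by rewrite -ab rep_meet; apply: subIsetr.
by apply: tinj; rewrite rep_meet; apply/setIidPl.
Qed.

Lemma rep_zero z : is_zero z <-> t z = set0.
Proof.
split=> [zz|tz a]; last by apply/rep_le; rewrite tz.
by rewrite -subset0; have /rep_le := zz (diff z z); rewrite td setDv.
Qed.

Lemma rep_nonzero z : ~ is_zero z <-> t z !=set0.
Proof.
rewrite rep_zero; split=> [/eqP/set0P//|/set0P/eqP//].
Qed.

Lemma rep_preceq a b : preceq a b <-> pdom (t a) `<=` pdom (t b).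
Proof.
rewrite /preceq rep_le tr; split=> [ab x [y /ab[]]//|ab [x y] axy].
by split=> //=; apply: ab; exists y.
Qed.

Lemma rep_sim a b : sim a b <-> pdom (t a) = pdom (t b).
Proof. by rewrite /sim !rep_preceq seteqP. Qed.

End Rep.

Section RepFacts.
Variable A : alg.
Hypothesis repA : representable A.
Implicit Types a b c x y : A.

Lemma le_refl a : le a a.
Proof. by have [X [Y [t [i p d r]]]] := rep_embed repA; apply/(rep_le i d). Qed.

Lemma le_trans b a c : le a b -> le b c -> le a c.
Proof.
have [X [Y [t [i p d r]]]] := rep_embed repA.
by rewrite !(rep_le i d); apply: subset_trans.
Qed.

Lemma le_meet a b c : le a b -> le a c -> le a (meet b c).
Proof.
have [X [Y [t [i p d r]]]] := rep_embed repA.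
by rewrite !(rep_le i d) (rep_meet d) => ab ac; rewrite subsetI.
Qed.

Lemma meet_le a b : le (meet a b) a.
Proof.
have [X [Y [t [i p d r]]]] := rep_embed repA.
by rewrite !(rep_le i d) (rep_meet d); apply: subIsetl.
Qed.

Lemma meet_ler a b : le (meet a b) b.
Proof.
have [X [Y [t [i p d r]]]] := rep_embed repA.
by rewrite !(rep_le i d) (rep_meet d); apply: subIsetr.
Qed.

Lemma le_diff a b c : le b a -> is_zero (meet b c) -> le b (diff a c).
Proof.
have [X [Y [t [i p d r]]]] := rep_embed repA.
rewrite !(rep_le i d) (rep_zero i d) (rep_meet d) d => ba bc q bq.
by split=> [|cq]; [exact: ba | have : set0 q by rewrite -bc].
Qed.

Lemma le_diff_zero a b : le b (diff a b) -> is_zero b.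
Proof.
have [X [Y [t [i p d r]]]] := rep_embed repA.
rewrite !(rep_le i d) (rep_zero i d) d => ba; rewrite -subset0 => q bq.
by have [] := ba q bq.
Qed.

Lemma diff_le a b : le (diff a b) a.
Proof.
have [X [Y [t [i p d r]]]] := rep_embed repA.
by rewrite !(rep_le i d) d; apply: subDsetl.
Qed.

Lemma le_zero a b : le a b -> is_zero b -> is_zero a.
Proof. by move=> ab bz c; apply: (le_trans ab). Qed.

Lemma zero_diff a : is_zero (diff a a).
Proof.
have [X [Y [t [i p d r]]]] := rep_embed repA.
by rewrite (rep_zero i d) d setDv.
Qed.

Lemma zero_uniq a b : is_zero a -> is_zero b -> a = b.
Proof.
have [X [Y [t [i p d r]]]] := rep_embed repA.
by rewrite !(rep_zero i d) => ta tb; apply: i; rewrite ta.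
Qed.

Lemma atom_meet x a : atom x -> ~ is_zero (meet x a) -> le x a.
Proof.
by move=> [_ xm] nz; case: (xm _ (meet_le x a)) => // e; rewrite -e; apply: meet_ler.
Qed.

Lemma sim_refl a : sim a a.
Proof. by have [X [Y [t [i p d r]]]] := rep_embed repA; apply/(rep_sim i d r). Qed.

Lemma sim_sym a b : sim a b -> sim b a.
Proof. by case. Qed.

Lemma sim_trans b a c : sim a b -> sim b c -> sim a c.
Proof.
have [X [Y [t [i p d r]]]] := rep_embed repA.
by rewrite !(rep_sim i d r) => ->.
Qed.

Lemma At_projE (x y : At A) : At_proj x = At_proj y <-> sim (sval x) (sval y).
Proof.
split=> [[e]|xy]; last first.
  apply: eq_exist; apply/seteqP; split=> z /= zz.
    exact: sim_trans (sim_sym xy) zz.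
  exact: sim_trans xy zz.
have : At_class x y by rewrite e; apply: sim_refl.
by [].
Qed.

Lemma atom_sim x y : atom x -> atom y ->
  ~ is_zero (dres y x) -> sim x y.
Proof.
have [X [Y [t [i p d r]]]] := rep_embed repA.
move=> ax ay /(rep_nonzero i d); rewrite r => -[[u v] /= [xuv /= [w yuw]]].
have e1 : dres y x = x.
  case: (proj2 ax (dres y x)) => //.
    by apply/(rep_le i d); rewrite r => q [].
  by move/(rep_zero i d); rewrite r => e; have : set0 (u, v) by rewrite -e; split=> //; exists w.
have e2 : dres x y = y.
  case: (proj2 ay (dres x y)) => //.
    by apply/(rep_le i d); rewrite r => q [].
  by move/(rep_zero i d); rewrite r => e; have : set0 (u, w) by rewrite -e; split=> //; exists v.
by split; rewrite /preceq ?e1 ?e2; apply: le_refl.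
Qed.

Lemma sim_below x y a : sim x y -> le x a -> le y a -> x = y.
Proof.
have [X [Y [t [i p d r]]]] := rep_embed repA.
rewrite (rep_sim i d r) !(rep_le i d) => e xa ya; apply: i.
apply/seteqP; split=> -[u v] uv.
  have [w uw] : pdom (t y) u by rewrite -e; exists v.
  by rewrite (p _ _ _ _ (xa _ uv) (ya _ uw)).
have [w uw] : pdom (t x) u by rewrite e; exists v.
by rewrite (p _ _ _ _ (ya _ uv) (xa _ uw)).
Qed.

Lemma atom_dres y a : atom y -> preceq y a ->
  atom (dres y a) /\ sim (dres y a) y.
Proof.
have [X [Y [t [i p d r]]]] := rep_embed repA.
move=> ay /(rep_preceq i d r) ya.
have sy : pdom (t (dres y a)) = pdom (t y).
  rewrite r; apply/seteqP; split=> [u [v []]//|u uy].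
  by have [v uv] := ya u uy; exists v.
have sub z : le z (dres y a) -> ~ is_zero z -> pdom (t z) = pdom (t y).
  move=> /(rep_le i d) zl /(rep_nonzero i d)[[u v] zuv].
  have [w ywu] : pdom (t y) u by rewrite -sy; exists v; apply: zl.
  have : dres z y = y.
    case: (proj2 ay (dres z y)) => //.
      by apply/(rep_le i d); rewrite r => q [].
    move/(rep_zero i d); rewrite r => e.
    by have : set0 (u, w) by rewrite -e; split=> //; exists v.
  move=> e; apply/seteqP; split=> [u' [v' zuv']|u' [v']].
    by rewrite -sy; exists v'; apply: zl.
  by rewrite -e r => -[].
split; last by apply/(rep_sim i d r).
split.
  move=> /(rep_zero i d) e; case: ay => /(rep_nonzero i d)[[u v] uv] _.
  have : pdom (t (dres y a)) u by rewrite sy; exists v.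
  by rewrite e => -[].
move=> z zl; have [zz|zz] := pselect (is_zero z); [by left|right].
apply: (sim_below _ zl (le_refl _)).
by apply/(rep_sim i d r); rewrite sy; apply: sub.
Qed.

Lemma le_dres y y' a b : sim y y' -> le y a -> le y' b -> le y (dres b a).
Proof.
have [X [Y [t [i p d r]]]] := rep_embed repA.
rewrite (rep_sim i d r) !(rep_le i d) r => e ya yb [u v] uv.
split; first exact: ya.
have [w uw] : pdom (t y') u by rewrite -e; exists v.
by exists w; apply: yb.
Qed.

Lemma dres_le a b : le (dres a b) b.
Proof.
by have [X [Y [t [i p d r]]]] := rep_embed repA; apply/(rep_le i d); rewrite r => q [].
Qed.

Lemma preceq_trans b a c : preceq a b -> preceq b c -> preceq a c.
Proof.
have [X [Y [t [i p d r]]]] := rep_embed repA.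
by rewrite !(rep_preceq i d r); apply: subset_trans.
Qed.

Lemma le_preceq a b : le a b -> preceq a b.
Proof.
have [X [Y [t [i p d r]]]] := rep_embed repA.
rewrite (rep_preceq i d r) (rep_le i d) => ab u [v uv].
by exists v; apply: ab.
Qed.

End RepFacts.

Lemma atoms_join (A : atRepAlg) (a : A) :
  is_join [set x | atom x /\ le x a] a.
Proof.
split=> [x []//|c cub].
have [X [Y [t [i p d r]]]] := rep_embed (ar_rep A).
apply: contrapT => nac.
have nz : ~ is_zero (diff a c).
  move=> /(rep_zero i d); rewrite d setD_eq0 => h.
  by apply: nac; apply/(rep_le i d).
have [x ax xac] := ar_atomic nz.
have xc := cub x (conj ax (le_trans (ar_rep A) xac (diff_le (ar_rep A) _ _))).
case: ax => nzx _; apply: nzx.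
move: xac xc; rewrite !(rep_le i d) (rep_zero i d) d => h1 h2.
by rewrite -subset0 => q xq; have [_] := h1 q xq; apply; apply: h2.
Qed.

Lemma hom_le (A B : alg) (h : A -> B) a b : alg_hom h -> le a b -> le (h a) (h b).
Proof. by rewrite /le /meet => -[hd _] ab; rewrite -!hd ab. Qed.

Lemma hom_zero (A B : alg) (h : A -> B) a : representable A -> representable B ->
  alg_hom h -> is_zero a -> is_zero (h a).
Proof.
move=> rA rB [hd _] za.
by rewrite (zero_uniq rA za (zero_diff rA a)) hd; apply: zero_diff.
Qed.

Definition F_rel (A B : atRepAlg) (h : complete_hom A B) :
    set (At B * At A) :=
  [set p | exists a, [/\ le (sval p.1) (h a), le (sval p.2) a
    & forall a', le a' a -> (le (sval p.2) a' <-> le (sval p.1) (h a'))]].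

Section FRel.
Variables (A B : atRepAlg) (h : complete_hom A B).
Let rA : representable A := ar_rep A.
Let rB : representable B := ar_rep B.
Let hh : alg_hom h := chom_hom h.

Lemma F_relE (y : At B) (x : At A) :
  F_rel h (y, x) <-> le (sval y) (h (sval x)).
Proof.
split=> [[a /= [_ xa e]]|yx]; first by apply/e => //; apply: le_refl.
exists (sval x); split=> //=; first exact: le_refl.
move=> a' a'x; split=> [xa'|ya'].
  exact: le_trans yx (hom_le hh xa').
case: (svalP x) => _ /(_ a' a'x)[za'|->]; last exact: le_refl.
by case: (svalP y) => + _; case; apply: le_zero ya' _ => //; apply: hom_zero.
Qed.

(* The atom determined by the defining property exists for every [a] with
   [y <= h a], so [F_rel h] has the expected domain; by [F_relE] it does not
   depend on [a]. *)
Lemma F_rel_dom (y : At B) a : le (sval y) (h a) ->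
  exists2 x : At A, le (sval x) a & F_rel h (y, x).
Proof.
move=> ya.
have [x [ax xa] yx] : exists2 x, atom x /\ le x a & le (sval y) (h x).
  apply: contrapT => no.
  have [_ lub] := @chom_complete _ _ h _ _ (atoms_join a).
  have yd : le (sval y) (diff (h a) (sval y)).
    apply: (le_trans rB ya); apply: lub => _ [x [ax xa] <-].
    apply: le_diff => //; first exact: hom_le.
    apply: contrapT => nz; apply: no; exists x => //.
    apply: (atom_meet rB (svalP y)) => mz; apply: nz.
    by apply: le_zero mz => //; apply: le_meet => //; [exact: meet_ler|exact: meet_le].
  by case: (svalP y) => + _; apply; apply: le_diff_zero yd.
by exists (exist _ x ax) => //; apply/F_relE.
Qed.

Lemma F_rel_pfun : pfun (F_rel h).
Proof.
move=> y x x' /F_relE yx /F_relE yx'.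
have nz : ~ is_zero (meet (sval x) (sval x')).
  move=> /(hom_zero rA rB hh) z; case: (svalP y) => + _; apply.
  apply: le_zero z => //; rewrite /meet !(proj1 hh).
  exact: le_meet.
have xx' := atom_meet rA (svalP x) nz.
case: (svalP x') => _ /(_ _ xx')[z|/sval_inj //].
by case: (svalP x).
Qed.

Lemma F_rel_pre (y y' : At B) (x x' : At A) :
  F_rel h (y, x) -> F_rel h (y', x') -> sim (sval y) (sval y') ->
  sim (sval x) (sval x').
Proof.
move=> /F_relE yx /F_relE yx' yy'.
apply: (atom_sim rA (svalP x) (svalP x')) => /(hom_zero rA rB hh).
rewrite (proj2 hh) => z; case: (svalP y) => + _; apply.
apply: le_zero z => //.
exact: le_dres yy' yx yx'.
Qed.

Definition F_obj (A : atRepAlg) : setq := SetqObj (@At_proj_surj A).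

Definition F_map : setq_hom (F_obj B) (F_obj A).
Proof.
apply: (@SetqHom (F_obj B) (F_obj A) (F_rel h)).
- exact: F_rel_pfun.
- move=> y y' x x' yx yx' /(At_projE rB) yy'; apply/(At_projE rA).
  exact: F_rel_pre yx yx' yy'.
- move=> c d _ y y' x [/F_relE /= yx yc _] [/F_relE /= yx' yc' _].
  have /(At_projE rB) s : At_proj y = At_proj y' by rewrite yc.
  by apply: sval_inj; apply: sim_below s yx yx'.
- move=> c d [[y x] /= /F_relE yx [<- <-]] x' /(At_projE rA) xx'.
  have [] := @atom_dres _ rB (sval y) (h (sval x')) (svalP y).
    apply: (preceq_trans rB (le_preceq rB yx)).
    by move: (proj2 xx'); rewrite /preceq => /(hom_le hh); rewrite (proj2 hh).
  move=> ay sy; exists (exist _ _ ay); split=> //=; last exact/(At_projE rA).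
    by apply/F_relE; apply: dres_le.
  exact/(At_projE rB).
Defined.

End FRel.

Definition F : functor AtRepAlg (op Setq).
Proof.
apply: (@Functor AtRepAlg (op Setq) F_obj (fun A B h => F_map h)).
- move=> A; apply: setq_hom_eq => y x /=; rewrite F_relE /=.
  split=> [yx|<-]; last exact/le_refl/ar_rep.
  case: (svalP x) => _ /(_ _ yx)[z|/sval_inj //].
  by case: (svalP y).
- move=> A B C h k; apply: setq_hom_eq => z x /=; rewrite F_relE /=; split.
    move=> /(@F_rel_dom _ _ h)[y yx zy]; exists y => //.
    exact: (proj2 (F_relE _ _ _)).
  case=> y /F_relE zy /F_relE yx; apply: le_trans zy _.
    exact: ar_rep.
  exact: hom_le (chom_hom h) yx.
Defined.

Section GObj.
Variable P : setq.

Definition proj_inv : set (qbase P * qset P) :=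
  [set p | p.1 = qproj p.2].

Definition G_car :=
  {f : set (qbase P * qset P) | pfun f /\ f `<=` proj_inv}.

Lemma G_diff_subproof (f g : G_car) :
  pfun (sval f `\` sval g) /\ sval f `\` sval g `<=` proj_inv.
Proof.
case: f g => f [pf sf] [g [pg sg]] /=; split=> [x y z [+ _] [+ _]|q [+ _]].
  exact: pf.
exact: sf.
Qed.

Lemma G_dres_subproof (f g : G_car) :
  pfun (pdres (sval f) (sval g)) /\ pdres (sval f) (sval g) `<=` proj_inv.
Proof.
case: f g => f [pf sf] [g [pg sg]] /=; split=> [x y z [+ _] [+ _]|q [+ _]].
  exact: pg.
exact: sg.
Qed.

Definition G_alg : alg :=
  Alg (fun f g : G_car => exist _ _ (G_diff_subproof f g))
      (fun f g : G_car => exist _ _ (G_dres_subproof f g)).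

Lemma G_ext (f g : G_alg) :
  (forall x, sval f (qproj x, x) <-> sval g (qproj x, x)) -> f = g.
Proof.
move=> fg; apply: sval_inj; apply/seteqP; case: f g fg => f [pf sf] [g [pg sg]] /= fg.
split=> -[x0 x] h.
  by have e : x0 = qproj x := sf _ h; subst x0; apply/fg.
by have e : x0 = qproj x := sg _ h; subst x0; apply/fg.
Qed.

Lemma G_rep : representable G_alg.
Proof.
exists (qbase P), (qset P), [set f | pfun f /\ f `<=` proj_inv], (fun f => sval f).
split=> //; split=> //.
- by exists set0; split=> // x y z [].
- by move=> f [].
- by move=> f g Kf Kg; apply: (G_diff_subproof (exist _ f Kf) (exist _ g Kg)).
- by move=> f g Kf Kg; apply: (G_dres_subproof (exist _ f Kf) (exist _ g Kg)).
- by move=> f _; apply: svalP.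
- by move=> f g _ _; apply: sval_inj.
- by move=> f Kf; exists (exist _ f Kf).
Qed.

Lemma G_le (f g : G_alg) : le f g <-> sval f `<=` sval g.
Proof. by apply: (@rep_le G_alg _ _ (fun f => sval f)) => //; apply: sval_inj. Qed.

Lemma G_zero (f : G_alg) : is_zero f <-> sval f = set0.
Proof. by apply: (@rep_zero G_alg _ _ (fun f => sval f)) => //; apply: sval_inj. Qed.

Lemma G_point_subproof (x : qset P) :
  pfun [set (qproj x, x)] /\ [set (qproj x, x)] `<=` proj_inv.
Proof. by split=> [x0 y z [_ ->] [_ ->]//|_ ->]. Qed.

Definition G_point (x : qset P) : G_alg := exist _ _ (G_point_subproof x).

Lemma G_point_atom x : atom (G_point x).
Proof.
split=> [/G_zero /= e|f /G_le /= fx].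
  by have : set0 (qproj x, x) by rewrite -e.
have [f0|/set0P [q fq]] := eqVneq (sval f) set0; first by left; apply/G_zero.
right; apply: sval_inj; apply/seteqP; split=> //= _ ->.
by rewrite -(fx _ fq).
Qed.

Lemma G_atomic : atomic G_alg.
Proof.
move=> f /G_zero/eqP/set0P[[x0 x] fx].
have e : x0 = qproj x := proj2 (svalP f) _ fx; subst x0.
by exists (G_point x); [exact: G_point_atom | apply/G_le => _ ->].
Qed.

Lemma G_join (S : set G_alg) s : is_join S s ->
  sval s = [set q | exists2 f, S f & sval f q].
Proof.
move=> [ub lub]; apply/seteqP; split; last first.
  by move=> q [f Sf fq]; have /G_le := ub f Sf; apply.
have us : [set q | exists2 f, S f & sval f q] `<=` sval s.
  by move=> q [f Sf fq]; have /G_le := ub f Sf; apply.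
have Ku : pfun [set q | exists2 f, S f & sval f q] /\
    [set q | exists2 f, S f & sval f q] `<=` proj_inv.
  split=> [x y z /us h1 /us h2|q /us]; first exact: (proj1 (svalP s)) h1 h2.
  exact: (proj2 (svalP s)).
apply: (proj1 (G_le s (exist _ _ Ku))); apply: lub => f Sf; apply/G_le => q fq /=.
by exists f.
Qed.

Definition G_obj : atRepAlg := AtRepAlgObj G_rep G_atomic.

End GObj.

Section GMap.
Variables (P Q : setq) (phi : setq_hom P Q).

Definition G_rel (g : set (qbase Q * qset Q)) : set (qbase P * qset P) :=
  [set (qproj p.1, p.1) | p in [set p | qmap phi p /\ g (qproj p.2, p.2)]].

Lemma G_relE g x : G_rel g (qproj x, x) <->
  exists2 y, qmap phi (x, y) & g (qproj y, y).
Proof.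
split=> [[[x' y] /= [xy gy] [_ e]]|[y xy gy]].
  by rewrite e in xy; exists y.
by exists (x, y).
Qed.

Lemma G_rel_subproof (g : G_car Q) :
  pfun (G_rel (sval g)) /\ G_rel (sval g) `<=` @proj_inv P.
Proof.
case: g => g [pg sg] /=; split; last by move=> _ [p _ <-].
move=> x0 _ _ [[x y] /= [xy gy] [<- <-]] [[x' y'] /= [xy' gy'] [e <-]].
have ey := qmap_Q1 xy' xy e; rewrite ey in gy'.
have eyy := pg _ _ _ gy gy'; subst y'.
by apply: Q2P xy xy' _.
Qed.

Definition G_fun (g : G_obj Q) : G_obj P := exist _ _ (G_rel_subproof g).

Lemma G_fun_hom : alg_hom G_fun.
Proof.
split=> f g; apply: G_ext => x /=; rewrite G_relE /=.
  split=> [[y xy [fy ngy]]|[/G_relE[y xy fy] ng]].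
    split; first by apply/G_relE; exists y.
    by case/G_relE=> y' xy'; rewrite (qmap_pfun xy' xy).
  exists y => //; split=> // gy; apply: ng; apply/G_relE.
  by exists y.
split=> [[y xy [gy [y' fy']]]|[/G_relE[y xy gy] [x' fx']]].
  split; first by apply/G_relE; exists y.
  have e : qproj y = qproj y' := proj2 (svalP f) _ fy'.
  have [x' xy' ex'] := Q3P xy (esym e).
  exists x'; rewrite -ex'; apply/G_relE; exists y' => //; by rewrite -e.
exists y => //; split=> //=.
case: fx' => [[x'' y'] /= [xy' fy'] [e _]].
by exists y'; rewrite (qmap_Q1 xy xy' (esym e)).
Qed.

Lemma G_fun_complete : complete G_fun.
Proof.
move=> S s js; have es := G_join js; split.
  move=> _ [f Sf <-]; apply/G_le => _ [[x y] /= [xy fy] <-].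
  by exists (x, y) => //=; split=> //; rewrite es; exists f.
move=> c ub; apply/G_le => _ [[x y] /= [xy sy] <-].
move: sy; rewrite es => -[f Sf fy].
have /G_le := ub _ (ex_intro2 _ _ f Sf erefl); apply.
by exists (x, y).
Qed.

Definition G_map : complete_hom (G_obj Q) (G_obj P) :=
  CompleteHom G_fun_hom G_fun_complete.

End GMap.

Definition G : functor (op Setq) AtRepAlg.
Proof.
apply: (@Functor (op Setq) AtRepAlg G_obj (fun Q P phi => G_map phi)).
- move=> P; apply: complete_hom_eq => g; apply: G_ext => x /=.
  by rewrite G_relE; split=> [[y /= <-]//|gx]; exists x.
- move=> P Q R phi psi; apply: complete_hom_eq => g; apply: G_ext => x /=.
  rewrite G_relE; split=> [[z /= [y xy yz] gz]|/G_relE[y xy /G_relE[z yz gz]]].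
    by apply/G_relE; exists y => //; apply/G_relE; exists z.
  by exists z => //=; exists y.
Defined.

Record signature := Signature {
  symb :> Type;
  arity : symb -> nat }.
Arguments arity {_} _.

Definition compat_preserving (A : alg) n (om : ('I_n -> A) -> A) :=
  forall a a' : 'I_n -> A,
    (forall i, compatible (a i) (a' i)) -> compatible (om a) (om a').

Definition completely_additive (A : alg) n (om : ('I_n -> A) -> A) :=
  forall (S : set A) (s : A), is_join S s ->
  forall (i : 'I_n) (a : 'I_n -> A),
    is_join [set om [eta a with i |-> s'] | s' in S] (om [eta a with i |-> s]).

Section AtRepAlgSig.
Variable sigma : signature.

Record atRepAlgS := AtRepAlgSObj {
  ars_red :> atRepAlg;
  ars_op : forall o : sigma, ('I_(arity o) -> ars_red) -> ars_red;
  ars_compat : forall o, compat_preserving (@ars_op o);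
  ars_additive : forall o, completely_additive (@ars_op o) }.
Arguments ars_op : clear implicits.

Record complete_homS (A B : atRepAlgS) := CompleteHomS {
  chomS :> complete_hom A B;
  chomS_op : forall (o : sigma) (a : 'I_(arity o) -> A),
    chomS (ars_op A o a) = ars_op B o (chomS \o a) }.

Lemma complete_homS_eq (A B : atRepAlgS) (h k : complete_homS A B) :
  (h : complete_hom A B) = k -> h = k.
Proof.
by case: h k => [h hh] [k kh] /= hk; subst k; rewrite (Prop_irrelevance hh kh).
Qed.

Definition chomS_id (A : atRepAlgS) : complete_homS A A :=
  @CompleteHomS A A (chom_id A) (fun _ _ => erefl).

Definition chomS_comp (A B C : atRepAlgS) (h : complete_homS B C)
    (k : complete_homS A B) : complete_homS A C.
Proof.
by apply: (@CompleteHomS A C (chom_comp h k)) => o a /=; rewrite !chomS_op.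
Defined.

Definition AtRepAlgS : category.
Proof.
apply: (@Category atRepAlgS complete_homS chomS_id chomS_comp).
- by move=> A B f; apply: complete_homS_eq; apply: complete_hom_eq.
- by move=> A B f; apply: complete_homS_eq; apply: complete_hom_eq.
- by move=> A B C D f g h; apply: complete_homS_eq; apply: complete_hom_eq.
Defined.

Definition reduct : functor AtRepAlgS AtRepAlg :=
  @Functor AtRepAlgS AtRepAlg ars_red (fun A B h => chomS h)
    (fun _ => erefl) (fun _ _ _ _ _ => erefl).

End AtRepAlgSig.

Definition Crel (P : setq) (x x' : qset P) := qproj x = qproj x' -> x = x'.

(* An (n+1)-ary relation is a predicate on its first [n] arguments, given as a
   function on ['I_n], and its last one. *)
Definition compat_property (P : setq) n
    (R : ('I_n -> qset P) -> qset P -> Prop) :=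
  forall (xs xs' : 'I_n -> qset P) (x x' : qset P),
    (forall i, Crel (xs i) (xs' i)) -> R xs x -> R xs' x' -> Crel x x'.

Section SetqSig.
Variable sigma : signature.

Record setqS := SetqSObj {
  qs_base :> setq;
  qs_rel : forall o : sigma, ('I_(arity o) -> qset qs_base) -> qset qs_base -> Prop;
  qs_compat : forall o, compat_property (@qs_rel o) }.
Arguments qs_rel : clear implicits.

Definition reverse_forth (P Q : setqS) (phi : setq_hom P Q) :=
  forall (o : sigma) (xs : 'I_(arity o) -> qset P) (x : qset P)
         (ys : 'I_(arity o) -> qset Q),
    qs_rel P o xs x -> (forall i, qmap phi (xs i, ys i)) ->
    exists2 y, qmap phi (x, y) & qs_rel Q o ys y.

Definition back (P Q : setqS) (phi : setq_hom P Q) :=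
  forall (o : sigma) (x : qset P) (y : qset Q) (ys : 'I_(arity o) -> qset Q),
    qmap phi (x, y) -> qs_rel Q o ys y ->
    exists2 xs : 'I_(arity o) -> qset P,
      forall i, qmap phi (xs i, ys i) & qs_rel P o xs x.

Record setqS_hom (P Q : setqS) := SetqSHom {
  qmapS :> setq_hom P Q;
  qmapS_forth : reverse_forth qmapS;
  qmapS_back : back qmapS }.

Lemma setqS_hom_eq (P Q : setqS) (f g : setqS_hom P Q) :
  (f : setq_hom P Q) = g -> f = g.
Proof.
case: f g => [f f1 f2] [g g1 g2] /= fg; subst g.
by rewrite (Prop_irrelevance f1 g1) (Prop_irrelevance f2 g2).
Qed.

Definition setqS_id (P : setqS) : setqS_hom P P.
Proof.
apply: (@SetqSHom P P (setq_id P)) => [o xs x ys /= Rx /funext <-|o x y ys /= <-].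
  by exists x.
by exists ys.
Defined.

Definition setqS_comp (P Q R : setqS) (psi : setqS_hom Q R)
    (phi : setqS_hom P Q) : setqS_hom P R.
Proof.
apply: (@SetqSHom P R (setq_comp psi phi)).
- move=> o xs x zs Rx.
  move=> h; have /choice[ys hy] : forall i, exists y, qmap phi (xs i, y) /\ qmap psi (y, zs i).
    by move=> i; case: (h i) => y; exists y.
  have [y xy Ry] := qmapS_forth Rx (fun i => proj1 (hy i)).
  have [z yz Rz] := qmapS_forth Ry (fun i => proj2 (hy i)).
  by exists z => //; exists y.
- move=> o x z zs [y xy yz] Rz.
  have [ys hy Ry] := qmapS_back yz Rz.
  have [xs hx Rx] := qmapS_back xy Ry.
  by exists xs => // i; exists (ys i); [exact: hx|exact: hy].
Defined.

Definition SetqS : category.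
Proof.
apply: (@Category setqS setqS_hom setqS_id setqS_comp).
- move=> P Q f; apply: setqS_hom_eq; exact: (@comp_idl Setq).
- move=> P Q f; apply: setqS_hom_eq; exact: (@comp_idr Setq).
- move=> P Q R S f g h; apply: setqS_hom_eq; exact: (@compA Setq).
Defined.

Definition forget_rel : functor SetqS Setq :=
  @Functor SetqS Setq qs_base (fun P Q f => qmapS f)
    (fun _ => erefl) (fun _ _ _ _ _ => erefl).

End SetqSig.

(* Main.v *)
From mathcomp Require Import all_boot.
From mathcomp Require Import boolp classical_sets.
Require Import Defs.
Set Implicit Arguments.
Unset Strict Implicit.
Unset Printing Implicit Defensive.
Local Open Scope classical_set_scope.

(** On atoms, a completely additive operation [om] is the relation
    [R xs x] that holds when [x <= om xs], and conversely an (n+1)-ary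
    relation on a set quotient acts on partial sections of its projection by
    taking images.  Such an image is again a partial section because of the compatibility property,
    and, in the other direction, compatibility preservation of [om] yields the
    compatibility property because two distinct equivalent atoms are never
    below compatible elements.

    These two passages lift [F] and [G] to the categories with operators
    without changing the underlying objects and maps, so the statements about
    reducts hold by construction.  The key to the rest is [additive_atoms]: an
    atom lies below [om a] iff it lies below [om xs] for some tuple of atoms
    [xs] below [a]; thus [om] is determined by its relation.  It is obtained by replacing
    one coordinate at a time: [a i] is the join of the atoms below it, [om]
    preserves this join in the i-th coordinate, and an atom below a join is
    below one of the joinands.

    The adjunction is given by unit and counit.  The unit [eta] sends [a] to
    the set of atoms below [a], viewed as a partial section of the projection of atoms
    onto their classes; the counit [eps] sends a point [x] of a set quotient
    to the atom [{(pi x, x)}] of its algebra of partial sections, and every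
    atom has this form.  Naturality and the triangle identities are equations between
    maps of the base categories.  It then remains to see that both families
    respect the operators: for [eta] this is [additive_atoms] again, for [eps]
    it is the fact that [eps] is a bijection carrying a relation to the one
    read off from its action on sections ([FS_rel_pt]). *)

(** * Generalities on functors and adjunctions *)

(** Only functors with convertible object parts are compared, which avoids
    transporting the morphism part along an equality of objects. *)
Lemma functor_eq (C D : category) (f : C -> D)
    (m m' : forall a b : C, hom a b -> hom (f a) (f b)) i c i' c' :
  m = m' -> @Functor C D f m i c = @Functor C D f m' i' c'.
Proof.
move=> e; subst m'.
by rewrite (Prop_irrelevance i i') (Prop_irrelevance c c').
Qed.

Lemma unit_counit_adjoint (C D : category) (F : functor C D) (G : functor D C)
    (eta : forall c : C, hom c (G (F c))) (eps : forall d : D, hom (F (G d)) d) :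
  (forall (c c' : C) (k : hom c' c),
     comp (eta c) k = comp (fmap G (fmap F k)) (eta c')) ->
  (forall (d d' : D) (g : hom d d'),
     comp g (eps d) = comp (eps d') (fmap F (fmap G g))) ->
  (forall d : D, comp (fmap G (eps d)) (eta (G d)) = idm (G d)) ->
  (forall c : C, comp (eps (F c)) (fmap F (eta c)) = idm (F c)) ->
  left_adjoint F G.
Proof.
move=> eta_nat eps_nat triG triF.
exists (fun c d f => comp (fmap G f) (eta c)); split=> [c d|c c' d d' k f g].
  exists (fun k => comp (eps d) (fmap F k)) => [f|k].
    by rewrite fmap_comp compA -eps_nat -compA triF comp_idr.
  by rewrite fmap_comp -compA -eta_nat compA triG comp_idl.
by rewrite !fmap_comp -!compA eta_nat.
Qed.

(** * Atoms and compatibility in representable algebras *)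

Section Atoms.
Variable A : alg.
Hypothesis rA : representable A.
Implicit Types (x y a b : A) (S : set A).

Lemma atom_le_diff x a b : atom x ->
  le x (diff a b) <-> le x a /\ ~ le x b.
Proof.
move=> ax; have [X [Y [t [i p d r]]]] := rep_embed rA; split=> [xab|[xa nxb]].
  split; first exact: le_trans xab (diff_le rA a b).
  move=> xb; case: ax => + _; apply; move: xab xb.
  rewrite !(rep_le i d) (rep_zero i d) d => xab xb.
  by rewrite -subset0 => q xq; have [_] := xab q xq; apply; apply: xb.
apply: le_diff => //; apply: contrapT => nz.
by apply: nxb; apply: atom_meet.
Qed.

(** Otherwise [x] would be disjoint from every element of [S], so [s - x]
    would already bound [S], against [x <= s]. *)
Lemma atom_le_join x S s : atom x -> is_join S s -> le x s ->
  exists2 b, S b & le x b.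
Proof.
move=> ax [ub lub] xs; apply: contrapT => no.
have : le x (diff s x).
  apply: le_trans xs _ => //; apply: lub => b Sb.
  apply: le_diff => //; first exact: ub.
  apply: contrapT => nz; apply: no; exists b => //.
  apply: (atom_meet rA ax) => mz; apply: nz.
  by apply: le_zero mz => //; apply: le_meet => //; [exact: meet_ler|exact: meet_le].
by move=> /(le_diff_zero rA); case: ax.
Qed.

(** For the forward direction, the atom below [a] is [dres x a]: restricting
    [a] to the domain of [x] cuts out an atom with that same domain. *)
Lemma atom_le_dres x a b : atom x ->
  le x (dres a b) <-> le x b /\ exists2 y, atom y & sim x y /\ le y a.
Proof.
move=> ax; split=> [xab|[xb [y _ [xy ya]]]]; last exact: le_dres xy xb ya.
have xa : preceq x a.
  have [X [Y [t [i p d r]]]] := rep_embed rA.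
  apply/(rep_preceq i d r) => u [v uv].
  by move/(rep_le i d): xab => /(_ _ uv); rewrite r => -[].
split; first exact: le_trans xab (dres_le rA a b).
have [ay sy] := atom_dres rA ax xa.
by exists (dres x a) => //; split; [exact: sim_sym|exact: dres_le].
Qed.

(** Inequivalent atoms have disjoint domains, hence both restrictions vanish. *)
Lemma compatible_atoms x y : atom x -> atom y -> (sim x y -> x = y) ->
  compatible x y.
Proof.
move=> ax ay xy; have [/xy -> //|nxy] := pselect (sim x y).
apply: (zero_uniq rA); apply: contrapT => nz; apply: nxy.
  exact/sim_sym/(atom_sim rA).
exact: (atom_sim rA).
Qed.

(** By equivalence [x] lies below [a] restricted to the domain of [b], which
    compatibility makes a part of [b]; below [b], equivalent elements
    coincide. *)
Lemma compatible_below a b x y : compatible a b -> le x a -> le y b ->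
  sim x y -> x = y.
Proof.
move=> ab xa yb xy; apply: (sim_below rA xy _ yb).
apply: (le_trans rA _ (dres_le rA a b)); rewrite ab.
exact: le_dres xy xa yb.
Qed.

End Atoms.

(** * Completely additive operations *)

Lemma update_self n (T : Type) (a : 'I_n -> T) i :
  [eta a with i |-> a i] = a :> ('I_n -> T).
Proof. by apply/funext => j /=; case: eqP => [->|]. Qed.

(** Principle for replacing the entries of a tuple one coordinate at a time.
    The step may use that the entry to be replaced is still the original one;
    as [Q] sees the whole tuple, choosing all entries at once would not do. *)
Lemma coordinatewise n (T : Type) (Q : ('I_n -> T) -> Prop)
    (r : 'I_n -> T -> Prop) (a : 'I_n -> T) :
  Q a ->
  (forall i b, Q b -> b i = a i ->
     exists2 t, r i t & Q [eta b with i |-> t]) ->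
  exists2 b, forall i, r i (b i) & Q b.
Proof.
move=> Qa step.
(* Invariant after [m] steps: the first [m] entries have been replaced. *)
suff ind m : m <= n -> exists2 b, Q b &
    forall i : 'I_n, (i < m -> r i (b i)) /\ (m <= i -> b i = a i).
  have [b Qb hb] := ind n (leqnn n).
  by exists b => // i; apply: (proj1 (hb i)).
elim: m => [|m IH] mn; first by exists a.
have [b Qb hb] := IH (ltnW mn).
have [t rt Qt] := step (Ordinal mn) b Qb (proj2 (hb (Ordinal mn)) (leqnn m)).
exists [eta b with Ordinal mn |-> t] => // i /=.
case: eqP => [->|/eqP ne]; first by split=> //=; rewrite ltnn.
have {}ne : (i : nat) != m by apply: contraNneq ne => e; apply/eqP/val_inj.
split=> im.
  by apply: (proj1 (hb i)); rewrite ltn_neqAle ne -ltnS.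
by apply: (proj2 (hb i)); apply: ltnW.
Qed.

Section Additive.
Variables (A : alg) (n : nat) (om : ('I_n -> A) -> A).
Hypotheses (rA : representable A) (addom : completely_additive om).

(** Complete additivity is stated for one coordinate at a time; each
    coordinate is raised by applying it to the join of a principal ideal. *)
Lemma additive_mono a b : (forall i, le (a i) (b i)) -> le (om a) (om b).
Proof.
move=> ab.
have [||b' /funext -> //] := @coordinatewise n A (fun c => le (om a) (om c))
  (fun i t => t = b i) a.
  exact: le_refl.
move=> i c ac ci; exists (b i) => //; apply: le_trans ac _ => //.
have j : is_join [set s | le s (b i)] (b i).
  by split=> // d; apply; apply: le_refl.
have [ub _] := addom j i c; apply: ub; exists (c i); last by rewrite update_self.
by rewrite /= ci.
Qed.

End Additive.

(** The relation of an operation on atoms determines the operation: this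
    makes the unit preserve operators and gives the back condition. *)
Lemma additive_atoms (A : atRepAlg) n (om : ('I_n -> A) -> A) (x : A) a :
  completely_additive om -> atom x ->
  le x (om a) <->
  exists2 xs : 'I_n -> At A, forall i, le (sval (xs i)) (a i) &
    le x (om (fun i => sval (xs i))).
Proof.
move=> addom ax; have rA := ar_rep A; split=> [xa|[xs xsa]]; last first.
  by move/(le_trans rA); apply; apply: additive_mono.
have [|b ba xb] := @coordinatewise n A (fun c => le x (om c))
    (fun i t => atom t /\ le t (a i)) a xa.
  move=> i b xb bi.
  have := addom _ _ (atoms_join (a i)) i b; rewrite -{2}bi update_self => j.
  have [_ [t ta <-] xt] := atom_le_join rA ax j xb.
  by exists t.
by exists (fun i => exist _ (b i) (proj1 (ba i))) => // i; case: (ba i).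
Qed.

(** * The unit and counit of the base adjunction *)

Section Unit.
Variable A : atRepAlg.
Let rA : representable A := ar_rep A.

Lemma eta_subproof (a : A) :
  let f := [set (At_proj x, x) | x in [set x : At A | le (sval x) a]] in
  pfun f /\ f `<=` @proj_inv (F_obj A).
Proof.
split=> [c x y [x' /= xa [<- <-]] [y' /= ya [e <-]]|_ [x _ <-] //].
apply: sval_inj; apply: (sim_below rA _ xa ya).
by apply/(At_projE rA)/eq_exist.
Qed.

Definition eta_fun (a : A) : G_obj (F_obj A) := exist _ _ (eta_subproof a).

Lemma eta_funE a (x : At A) :
  sval (eta_fun a) (At_proj x, x) <-> le (sval x) a.
Proof. by split=> [[y /= ya [_ <-]]|xa]; last exists x. Qed.

Lemma eta_hom : alg_hom eta_fun.
Proof.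
split=> a b; apply: G_ext => x; have ax := svalP x.
  rewrite eta_funE (atom_le_diff _ _ _ ax) //=.
  by split=> -[/eta_funE ? nxb]; split=> // /eta_funE.
rewrite eta_funE (atom_le_dres _ _ _ ax) //=; split.
  move=> [xb [y ay [xy ya]]]; split; first exact/eta_funE.
  exists (exist _ y ay).
  have /= -> : At_proj x = At_proj (exist _ y ay) by apply/(At_projE rA).
  exact/eta_funE.
move=> [/eta_funE xb [_ [y /= ya [e _]]]]; split=> //.
exists (sval y); first exact: svalP.
by split=> //; apply/(At_projE rA)/eq_exist.
Qed.

(** Joins of sections are unions, so completeness amounts to an atom below a
    join being below a joinand. *)
Lemma eta_complete : complete eta_fun.
Proof.
move=> S s js; split=> [_ [a Sa <-]|c ub].
  apply/G_le => _ [x /= xa <-]; apply/eta_funE.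
  exact: le_trans xa (proj1 js a Sa).
apply/G_le => _ [x /= xs <-].
have [a Sa xa] := atom_le_join rA (svalP x) js xs.
have /G_le := ub _ (ex_intro2 _ _ a Sa erefl); apply.
exact/eta_funE.
Qed.

Definition eta : complete_hom A (G_obj (F_obj A)) :=
  CompleteHom eta_hom eta_complete.

End Unit.

Section Points.
Variable P : setq.

Lemma G_point_le (x : qset P) (f : G_alg P) :
  le (G_point x) f <-> sval f (qproj x, x).
Proof. by rewrite G_le; split=> [|fx _ ->//]; apply. Qed.

Lemma G_point_inj : injective (@G_point P).
Proof.
move=> x y e; have /G_point_le /= [_ ->//] : le (G_point x) (G_point y).
by rewrite e; apply/le_refl/G_rep.
Qed.

Lemma G_point_sim (x y : qset P) :
  sim (G_point x) (G_point y) <-> qproj x = qproj y.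
Proof.
have R := @rep_sim (G_alg P) _ _ (fun f => sval f) (@sval_inj _ _)
  (fun _ _ => erefl) (fun _ _ => erefl).
rewrite R /=; split=> e.
  have : pdom [set (qproj x, x)] (qproj x) by exists x.
  by rewrite e => -[z [->]].
by apply/seteqP; split=> u [v [-> _]]; [exists y|exists x]; rewrite /= e.
Qed.

Lemma G_atom_point (f : G_alg P) : atom f -> exists x, f = G_point x.
Proof.
move=> [/G_zero/eqP/set0P[[x0 x] fx] fmin]; exists x.
have e : x0 = qproj x := proj2 (svalP f) _ fx; subst x0.
have [z|-> //] := fmin (G_point x) (proj2 (G_point_le x f) fx).
by case: (G_point_atom x).
Qed.

(** Two partial sections are compatible when they agree over the common part of
    their domains; phrased with [Crel], this is what the compatibility property
    of relations speaks about. *)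
Lemma G_compatible (f g : G_alg P) :
  compatible f g <->
  forall x y, sval f (qproj x, x) -> sval g (qproj y, y) -> Crel x y.
Proof.
split=> [fg x y /G_point_le fx /G_point_le gy /G_point_sim xy|fg].
  exact/G_point_inj/(compatible_below (@G_rep P) fg fx gy xy).
have sub (h k : G_alg P) :
    (forall x y, sval h (qproj x, x) -> sval k (qproj y, y) -> Crel x y) ->
    forall x, sval (dres h k) (qproj x, x) -> sval (dres k h) (qproj x, x).
  move=> hk x [/= kx [y hy]]; have e : qproj x = qproj y := proj2 (svalP h) _ hy.
  move: (hy); rewrite e => /hk /(_ kx (esym e)) yx; subst y.
  by split=> //; exists x.
apply: G_ext => x; split; apply: sub => // y z gy fz e.
by apply/esym/fg.
Qed.

Definition G_pt (x : qset P) : At (G_obj P) := exist _ _ (G_point_atom x).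

Lemma G_ptP (f : At (G_obj P)) : exists x, f = G_pt x.
Proof.
by have [x fx] := G_atom_point (svalP f); exists x; apply: sval_inj.
Qed.

Lemma G_pt_proj (x y : qset P) : At_proj (G_pt x) = At_proj (G_pt y) <-> qproj x = qproj y.
Proof. by rewrite At_projE; [exact: G_point_sim|exact: G_rep]. Qed.

Definition eps : setq_hom P (F_obj (G_obj P)).
Proof.
apply: (@SetqHom P (F_obj (G_obj P)) [set p | p.2 = G_pt p.1]).
- by move=> x f g /= -> ->.
- by move=> x x' f f' /= -> -> /G_pt_proj.
- move=> x0 f0 _ x x' f [/= -> _ _] [/= e _ _].
  by apply: G_point_inj; apply: (congr1 sval e).
- move=> x0 f0 [[x f] /= -> [<- <-]] f'; have [x' ->] := G_ptP f'.
  by move=> /G_pt_proj e; exists x'; split=> //=; apply/G_pt_proj.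
Defined.

Lemma epsE x f : qmap eps (x, f) <-> f = G_pt x.
Proof. by []. Qed.

End Points.

Lemma eta_natural (A B : atRepAlg) (k : complete_hom A B) :
  chom_comp (eta B) k = chom_comp (G_map (F_map k)) (eta A).
Proof.
apply: complete_hom_eq => a; apply: G_ext => x; split.
  move=> /eta_funE/F_rel_dom[y ya xy]; apply/G_relE.
  by exists y => //; apply/eta_funE.
move=> /G_relE[y /F_relE xy /eta_funE ya]; apply/eta_funE.
exact: (le_trans (ar_rep B) xy (hom_le (chom_hom k) ya)).
Qed.

Lemma eps_natural (P Q : setq) (phi : setq_hom P Q) :
  setq_comp (eps Q) phi = setq_comp (F_map (G_map phi)) (eps P).
Proof.
apply: setq_hom_eq => x f /=; split.
  move=> [y xy ->]; exists (G_pt x) => //; apply/F_relE/G_point_le/G_relE.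
  by exists y.
move=> [_ -> /F_relE]; have [y ->] := G_ptP f => /G_point_le/G_relE[z xz].
by case=> _ <-; exists z.
Qed.

Lemma G_eps_eta (P : setq) :
  chom_comp (G_map (eps P)) (eta (G_obj P)) = chom_id (G_obj P).
Proof.
apply: complete_hom_eq => f; apply: G_ext => x; split=> [/G_relE[_ /epsE ->]|fx].
  by move=> /eta_funE/G_point_le.
by apply/G_relE; exists (G_pt x) => //; apply/eta_funE/G_point_le.
Qed.

Lemma eps_F_eta (A : atRepAlg) :
  setq_comp (F_map (eta A)) (eps (F_obj A)) = setq_id (F_obj A).
Proof.
apply: setq_hom_eq => x y /=; split=> [[_ -> /F_relE/G_point_le/eta_funE xy]|<-].
  have [yz|] := proj2 (svalP y) _ xy; last exact: sval_inj.
  by case: (svalP x).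
exists (G_pt (x : qset (F_obj A))) => //; apply/F_relE/G_point_le/eta_funE.
exact/le_refl/ar_rep.
Qed.

(** * The functors with operators *)

Section Operators.
Variable sigma : signature.
Arguments ars_op {sigma} _ _ _.
Arguments qs_rel {sigma} _ _ _ _.

Section FSObj.
Variable A : atRepAlgS sigma.
Let rA : representable A := ar_rep A.

Definition FS_rel (o : sigma) (xs : 'I_(arity o) -> At A) (x : At A) : Prop :=
  le (sval x) (ars_op A o (fun i => sval (xs i))).

Lemma FS_compat o : @compat_property (F_obj A) _ (@FS_rel o).
Proof.
move=> xs ys x y xsys xxs yys /(At_projE rA) xy; apply: sval_inj.
apply: (compatible_below rA) xxs yys xy; apply: ars_compat => i.
apply: (compatible_atoms rA) => [||/(At_projE rA) /xsys -> //]; exact: svalP.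
Qed.

Definition FS_obj : setqS sigma := SetqSObj FS_compat.

End FSObj.

Section FSMap.
Variables (A B : atRepAlgS sigma) (h : complete_homS A B).

(** From [y <= om ys] and [ys <= h xs], monotonicity gives
    [y <= om (h xs) = h (om xs)], so [y] has an image below [om xs]. *)
Lemma FS_forth : @reverse_forth sigma (FS_obj B) (FS_obj A) (F_map h).
Proof.
move=> o ys y xs yys ysxs.
have /(F_rel_dom (h := h))[x xxs yx] :
    le (sval y) (h (ars_op A o (fun i => sval (xs i)))).
  rewrite chomS_op; apply: le_trans yys _; first exact: ar_rep.
  apply: (additive_mono (ar_rep B) (@ars_additive _ B o)) => i.
  by have /F_relE := ysxs i.
by exists x.
Qed.

(** Here [y <= h (om xs) = om (h xs)], and [additive_atoms] supplies atoms
    below the [h xs i], that is, preimages of the [xs i]. *)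
Lemma FS_back : @back sigma (FS_obj B) (FS_obj A) (F_map h).
Proof.
move=> o y x xs /F_relE yx xxs.
have : le (sval y) (ars_op B o (h \o (fun i => sval (xs i)))).
  rewrite -chomS_op; apply: le_trans yx _; first exact: ar_rep.
  exact: hom_le (chom_hom h) xxs.
move=> /(additive_atoms _ (@ars_additive _ B o) (svalP y))[ys ysxs yys].
by exists ys => // i; apply/F_relE; apply: ysxs.
Qed.

Definition FS_map : setqS_hom (FS_obj B) (FS_obj A) := SetqSHom FS_forth FS_back.

End FSMap.

Section GSObj.
Variable P : setqS sigma.

Definition GS_rel (o : sigma) (f : 'I_(arity o) -> G_obj P) :
    set (qbase P * qset P) :=
  [set p | p.1 = qproj p.2 /\ exists2 xs, qs_rel P o xs p.2 &
    forall i, sval (f i) (qproj (xs i), xs i)].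

(** With [f = g] this shows that the image of sections is a section; in general
    it shows that the operation preserves compatibility. *)
Lemma GS_rel_compat o (f g : 'I_(arity o) -> G_obj P) x y :
  (forall i, compatible (f i) (g i)) ->
  GS_rel f (qproj x, x) -> GS_rel g (qproj y, y) -> Crel x y.
Proof.
move=> fg [_ [xs Rx fxs]] [_ [ys Ry gys]].
apply: qs_compat Rx Ry => i.
by move/G_compatible: (fg i); apply.
Qed.

Lemma GS_op_subproof o (f : 'I_(arity o) -> G_obj P) :
  pfun (GS_rel f) /\ GS_rel f `<=` @proj_inv P.
Proof.
split=> [x0 x y fx fy|p [] //].
have ex : x0 = qproj x := proj1 fx; have ey : x0 = qproj y := proj1 fy.
apply: (@GS_rel_compat o f f); [by []|by rewrite -ex|by rewrite -ey|].
by rewrite -ex.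
Qed.

Definition GS_op o (f : 'I_(arity o) -> G_obj P) : G_obj P :=
  exist _ _ (GS_op_subproof f).

Lemma GS_opE o (f : 'I_(arity o) -> G_obj P) x :
  sval (GS_op f) (qproj x, x) <->
  exists2 xs, qs_rel P o xs x & forall i, sval (f i) (qproj (xs i), xs i).
Proof. by split=> [[]|]. Qed.

Lemma GS_op_compat o : compat_preserving (@GS_op o).
Proof. by move=> f g fg; apply/G_compatible => x y; apply: GS_rel_compat. Qed.

Lemma GS_op_additive o : completely_additive (@GS_op o).
Proof.
move=> S s js i a; have es := G_join js; split=> [_ [s' Ss' <-]|c ub].
  apply/G_le => -[x0 x] [/= -> [xs Rx axs]]; apply/GS_opE; exists xs => // j.
  have := axs j => /=; case: eqP => // _ ?; rewrite es.
  by exists s'.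
apply/G_le => -[x0 x] [/= -> [xs Rx axs]].
have := axs i; rewrite /= eqxx es => -[s' Ss' s'x].
have /G_le := ub _ (ex_intro2 _ _ s' Ss' erefl); apply; apply/GS_opE.
by exists xs => // j; have := axs j => /=; case: eqP => // ->.
Qed.

Definition GS_obj : atRepAlgS sigma :=
  @AtRepAlgSObj sigma (G_obj P) GS_op GS_op_compat GS_op_additive.

End GSObj.

Section GSMap.
Variables (P Q : setqS sigma) (phi : setqS_hom P Q).

(** The back condition gives the inclusion from left to right, the reverse forth
    condition the other one. *)
Lemma GS_map_op (o : sigma) (g : 'I_(arity o) -> GS_obj Q) :
  G_map phi (ars_op (GS_obj Q) o g) = ars_op (GS_obj P) o (G_map phi \o g).
Proof.
apply: G_ext => x; split.
  move=> /G_relE[y xy /GS_opE[ys Ry gys]].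
  have [xs xsys Rx] := qmapS_back xy Ry; apply/GS_opE.
  by exists xs => // i; apply/G_relE; exists (ys i).
move=> /GS_opE[xs Rx gxs]; apply/G_relE.
have /choice[ys xsys] : forall i, exists y,
    qmap phi (xs i, y) /\ sval (g i) (qproj y, y).
  by move=> i; have /G_relE[y xy gy] := gxs i; exists y.
have [y xy Ry] := qmapS_forth Rx (fun i => proj1 (xsys i)).
by exists y => //; apply/GS_opE; exists ys => // i; case: (xsys i).
Qed.

Definition GS_map : complete_homS (GS_obj Q) (GS_obj P) :=
  @CompleteHomS sigma (GS_obj Q) (GS_obj P) (G_map phi) GS_map_op.

End GSMap.

Definition FS : functor (AtRepAlgS sigma) (op (SetqS sigma)).
Proof.
apply: (@Functor (AtRepAlgS sigma) (op (SetqS sigma)) FS_obj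
  (fun A B h => FS_map h)) => [A|A B C h k].
  by apply: setqS_hom_eq; apply: (fmap_id F (ars_red A)).
apply: setqS_hom_eq; exact: (@fmap_comp _ _ F A B C).
Defined.

Definition GS : functor (op (SetqS sigma)) (AtRepAlgS sigma).
Proof.
apply: (@Functor (op (SetqS sigma)) (AtRepAlgS sigma) GS_obj
  (fun Q P phi => GS_map phi)) => [P|P Q R phi psi].
  by apply: complete_homS_eq; apply: (fmap_id G (qs_base P)).
apply: complete_homS_eq; exact: (@fmap_comp _ _ G P Q R).
Defined.

Lemma eta_op (A : atRepAlgS sigma) (o : sigma) (a : 'I_(arity o) -> A) :
  eta A (ars_op A o a) = ars_op (GS_obj (FS_obj A)) o (eta A \o a).
Proof.
have atomsE := additive_atoms _ (@ars_additive _ A o) (svalP _).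
apply: G_ext => x; split=> [/eta_funE/atomsE[xs xsa xxs]|].
  by apply/GS_opE; exists xs => // i; apply/eta_funE.
move=> /GS_opE[xs xxs xsa]; apply/eta_funE/atomsE; exists xs => // i.
by have /eta_funE := xsa i.
Qed.

Definition etaS (A : atRepAlgS sigma) : complete_homS A (GS_obj (FS_obj A)) :=
  @CompleteHomS sigma A (GS_obj (FS_obj A)) (eta A) (@eta_op A).

(** Points name the atoms of the algebra of sections, and the image of singleton
    sections returns the original relation. *)
Lemma FS_rel_pt (P : setqS sigma) o (xs : 'I_(arity o) -> qset P) (x : qset P) :
  qs_rel (FS_obj (GS_obj P)) o (fun i => G_pt (xs i)) (G_pt x) <->
  qs_rel P o xs x.
Proof.
rewrite /= /FS_rel G_point_le GS_opE /=; split=> [[ys Ry ysxs]|Rx].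
  by have <- : ys = xs by apply/funext => i; case: (ysxs i).
by exists xs.
Qed.

Lemma eps_forth (P : setqS sigma) :
  @reverse_forth sigma P (FS_obj (GS_obj P)) (eps P).
Proof.
move=> o xs x ys Rx /= /funext ->; exists (G_pt x) => //.
exact/FS_rel_pt.
Qed.

Lemma eps_back (P : setqS sigma) : @back sigma P (FS_obj (GS_obj P)) (eps P).
Proof.
move=> o x _ ys /= ->.
have /choice[xs /funext ->] : forall i, exists x, ys i = G_pt x.
  by move=> i; apply: G_ptP.
by move=> /FS_rel_pt Rx; exists xs.
Qed.

Definition epsS (P : setqS sigma) : setqS_hom P (FS_obj (GS_obj P)) :=
  SetqSHom (@eps_forth P) (@eps_back P).

Lemma FS_GS_adjoint : left_adjoint FS GS.
Proof.
apply: (@unit_counit_adjoint _ _ FS GS etaS epsS) => [A B k|Q P phi|P|A].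
- by apply: complete_homS_eq; apply: eta_natural.
- by apply: setqS_hom_eq; apply: eps_natural.
- by apply: complete_homS_eq; apply: G_eps_eta.
- by apply: setqS_hom_eq; apply: eps_F_eta.
Qed.

End Operators.

Theorem theorem5p6 (sigma : signature) :
  exists (F' : functor (AtRepAlgS sigma) (op (SetqS sigma)))
         (G' : functor (op (SetqS sigma)) (AtRepAlgS sigma)),
    [/\ left_adjoint F' G',
        functor_comp (functor_op (forget_rel sigma)) F' =
          functor_comp F (reduct sigma)
      & functor_comp (reduct sigma) G' =
          functor_comp G (functor_op (forget_rel sigma))].
Proof.
exists (FS sigma), (GS sigma); split; first exact: FS_GS_adjoint.
- exact: functor_eq.
- exact: functor_eq.
Qed.
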